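(* Let $q$ be a power of $2$. In $\mathrm{PG}(3,q)$ let $H_\infty$ be the plane $X_0=0$, let $\mathcal C$ be the conic $X_1X_3-X_2^2=0$ in $H_\infty$, let $N=(0,0,1,0)$ be its nucleus and $\mathcal O=\mathcal C\cup\{N\}$. Let $T_2^*(\mathcal O)$ be the incidence structure whose points are the points of $\mathrm{PG}(3,q)$ not in $H_\infty$ and whose lines are the lines of $\mathrm{PG}(3,q)$ not contained in $H_\infty$ that pass through a point of $\mathcal O$; consider its adjacency graph (points adjacent iff distinct and on a common line of $T_2^*(\mathcal O)$). If $\ell_1,\ell_2,\ell_3$ are three lines of $T_2^*(\mathcal O)$ containing $N$ and spanning $\mathrm{PG}(3,q)$, then the set of affine points (points not in $H_\infty$) of $\ell_1\cup\ell_2\cup\ell_3$ is an identifying code of this adjacency graph.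
   Context: For a graph and a vertex $u$, $N[u]$ denotes the closed neighbourhood of $u$. An identifying code is a set $C$ of vertices such that $N[u]\cap C\neq\emptyset$ for every vertex $u$ and $N[u]\cap C\neq N[v]\cap C$ for all distinct vertices $u,v$. The nucleus $N$ of $\mathcal C$ is the point common to all tangent lines of $\mathcal C$ in $H_\infty$. $T_2^*(\mathcal O)$ is a generalized quadrangle $\mathrm{GQ}(q-1,q+1)$. *)

(* Defs.v *)
From HB Require Import structures.
From mathcomp Require Import all_boot all_order all_algebra.
From mathcomp Require Import ring.

Set Implicit Arguments.
Unset Strict Implicit.
Unset Printing Implicit Defensive.

Import GRing.Theory.
Local Open Scope ring_scope.

Definition closed_nbhd (V : finType) (adj : rel V) (u : V) : {set V} :=
  [set v | (v == u) || adj u v].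

Definition identifying_code (V : finType) (adj : rel V) (C : {set V}) : Prop :=
  (forall u, closed_nbhd adj u :&: C != set0) /\
  (forall u v, u != v -> closed_nbhd adj u :&: C != closed_nbhd adj v :&: C).

Import VectorInternalTheory.

HB.instance Definition _ (F : finFieldType) (vT : vectType F) :=
  [Countable of {vspace vT} by <:].
HB.instance Definition _ (F : finFieldType) (vT : vectType F) :=
  [Finite of {vspace vT} by <:].

(* Points and lines of PG(3, F) are the subspaces of F^4 of dimension 1 and 2;
   incidence is inclusion.  A vector v has coordinates X_i = v 0 i. *)
Definition pg_point (F : finFieldType) :=
  {P : {vspace 'rV[F]_4} | \dim P == 1%N}.

Definition pg_line (F : finFieldType) :=
  {l : {vspace 'rV[F]_4} | \dim l == 2%N}.

Definition in_Hinf (F : finFieldType) (U : {vspace 'rV[F]_4}) : bool :=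
  [forall v in U, v 0 0 == 0].

Definition conic (F : finFieldType) : {set pg_point F} :=
  [set P | in_Hinf (val P) &
           [forall v in val P, v 0 1 * v 0 3 - v 0 2 ^+ 2 == 0]].

(* (0, 0, 1, 0); that it spans the nucleus of the conic in characteristic 2 is
   nucleusP below. *)
Definition nucleus_vec (F : finFieldType) : 'rV[F]_4 := delta_mx 0 2.

Lemma dim_nucleus (F : finFieldType) : \dim <[nucleus_vec F]> == 1%N.
Proof.
rewrite dim_vline; suff -> : nucleus_vec F != 0 by [].
by apply/eqP => /rowP/(_ 2)/eqP; rewrite !mxE !eqxx oner_eq0.
Qed.

Definition nucleus (F : finFieldType) : pg_point F :=
  exist _ <[nucleus_vec F]>%VS (dim_nucleus F).

Definition hyperoval (F : finFieldType) : {set pg_point F} :=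
  nucleus F |: conic F.

Definition affine_point (F : finFieldType) :=
  {P : pg_point F | ~~ in_Hinf (val P)}.

Definition T2star_lines (F : finFieldType) : {set pg_line F} :=
  [set l | ~~ in_Hinf (val l) &
           [exists P in hyperoval F, (val P <= val l)%VS]].

Definition affine_on (F : finFieldType) (P : affine_point F) (l : pg_line F) :
    bool :=
  (val (val P) <= val l)%VS.

Definition T2star_adj (F : finFieldType) : rel (affine_point F) :=
  fun P Q => (P != Q) &&
    [exists l in T2star_lines F, affine_on P l && affine_on Q l].

Definition tangent_line (F : finFieldType) (l : pg_line F) : bool :=
  in_Hinf (val l) && (#|[set P in conic F | (val P <= val l)%VS]| == 1%N).

Lemma conic_mem (F : finFieldType) (v : 'rV[F]_4) (P : pg_point F) :
  val P = <[v]>%VS -> v 0 0 = 0 -> v 0 1 * v 0 3 = v 0 2 ^+ 2 -> P \in conic F.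
Proof.
move=> eP v0 vq; rewrite inE /in_Hinf eP.
apply/andP; split; apply/forall_inP => _ /vlineP[k ->]; rewrite !mxE.
  by rewrite v0 mulr0.
by rewrite mulrACA vq -!expr2 -exprMn subrr.
Qed.

Lemma pg_point_gen (F : finFieldType) (v : 'rV[F]_4) :
  v != 0 -> exists P : pg_point F, val P = <[v]>%VS.
Proof.
move=> v0; have dv : \dim <[v]>%VS == 1%N by rewrite dim_vline v0.
by exists (exist _ <[v]>%VS dv).
Qed.

Lemma pg_pointE (F : finFieldType) (P : pg_point F) :
  exists2 v : 'rV[F]_4, v != 0 & val P = <[v]>%VS.
Proof.
have dP : \dim (val P) = 1%N := eqP (valP P).
have v0 : vpick (val P) != 0 by rewrite vpick0 -dimv_eq0 dP.
exists (vpick (val P)) => //; apply/esym/eqP.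
by rewrite eqEdim -memvE memv_pick /= dim_vline v0 dP.
Qed.

Lemma nucleus_on_tangent (F : finFieldType) (l : pg_line F) :
  2 \in [pchar F] -> tangent_line l -> (val (nucleus F) <= val l)%VS.
Proof.
move=> char2 /andP[/forall_inP lH /cards1P[P0 eP0]].
have P0P : P0 \in [set P in conic F | (val P <= val l)%VS] by rewrite eP0 set11.
move: P0P; rewrite inE => /andP[]; rewrite inE => /andP[/forall_inP PH /forall_inP Pq] Pl.
have [p p0 eP] := pg_pointE P0; rewrite eP in PH Pq Pl.
have /eqP px0 := PH p (memv_line p); have /eqP := Pq p (memv_line p).
move=> /eqP; rewrite subr_eq0 => /eqP pq.
have dl : \dim (val l) = 2%N := eqP (valP l).
have pl : p \in val l by rewrite memvE.
have [w wl wp] : exists2 w, w \in val l & w \notin <[p]>%VS.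
  by apply/subvPn; apply/negP => /dimvS; rewrite dl dim_vline p0.
have /eqP wx0 := lH w wl.
pose B := p 0 1 * w 0 3 + w 0 1 * p 0 3.
have B0 : B = 0.
  apply/eqP; apply: contraNT wp => nB.
  pose t := (w 0 2 ^+ 2 - w 0 1 * w 0 3) / B.
  have [z0|z0] := eqVneq (t *: p + w) 0.
    by move/eqP: z0; rewrite addrC addr_eq0 => /eqP ->; rewrite rpredN rpredZ ?memv_line.
  have [R eR] := pg_point_gen z0.
  have : R \in [set P in conic F | (val P <= val l)%VS].
    rewrite inE; apply/andP; split; last first.
      by rewrite eR -memvE rpredD // rpredZ.
    apply: (conic_mem eR); rewrite !mxE ?px0 ?wx0 ?mulr0 ?addr0 //.
    have -> : (t * p 0 2 + w 0 2) ^+ 2 = (t * p 0 2) ^+ 2 + w 0 2 ^+ 2.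
      by rewrite sqrrD -[X in _ + X + _]mulr_natr (pcharf0 char2) mulr0 addr0.
    have -> : w 0 2 ^+ 2 = t * B + w 0 1 * w 0 3 by rewrite divfK // subrK.
    by rewrite exprMn -pq /B; ring.
  rewrite eP0 inE => /eqP eRP; move: eR; rewrite eRP eP => e.
  have : t *: p + w \in <[p]>%VS by rewrite e memv_line.
  by rewrite rpredDl // rpredZ // memv_line.
have eB : p 0 1 * w 0 3 = p 0 3 * w 0 1.
  by apply/eqP; rewrite -subr_eq0 oppr_pchar2 // -[X in _ + X]mulrC; apply/eqP.
have key c d : d != 0 -> d * w 0 1 = c * p 0 1 -> d * w 0 3 = c * p 0 3 ->
    (val (nucleus F) <= val l)%VS.
  move=> d0 e1 e3; pose u := d *: w - c *: p.
  have ul : u \in val l by rewrite rpredB // rpredZ.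
  have uE : u = u 0 2 *: nucleus_vec F.
    apply/rowP => i; rewrite !mxE eqxx /=.
    case: i => [[|[|[|[|//]]]] hi].
    - rewrite (_ : Ordinal hi = 0); last exact: val_inj.
      by rewrite wx0 px0 !mulr0 subrr.
    - rewrite (_ : Ordinal hi = 1); last exact: val_inj.
      by rewrite e1 subrr mulr0.
    - rewrite (_ : Ordinal hi = 2); last exact: val_inj.
      by rewrite eqxx mulr1.
    - rewrite (_ : Ordinal hi = 3); last exact: val_inj.
      by rewrite e3 subrr mulr0.
  have u20 : u 0 2 != 0.
    apply: contraNneq wp => u2; move: uE; rewrite u2 scale0r => /eqP.
    rewrite subr_eq0 => /eqP dw.
    by rewrite -[w](scalerK d0) dw !rpredZ // memv_line.
  by rewrite -memvE -[nucleus_vec F](scalerK u20) -uE rpredZ.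
have [a0|a0] := eqVneq (p 0 1) 0; last by apply: (key (w 0 1) (p 0 1)); rewrite // ?eB mulrC.
have [c0|c0] := eqVneq (p 0 3) 0; last by apply: (key (w 0 3) (p 0 3)); rewrite // -?eB mulrC.
case/eqP: p0; apply/rowP => i; rewrite mxE.
move: pq; rewrite a0 mul0r => /esym/eqP; rewrite sqrf_eq0 => /eqP b0.
case: i => [[|[|[|[|//]]]] hi].
- by rewrite -[RHS]px0; congr (p _ _); apply: val_inj.
- by rewrite -[RHS]a0; congr (p _ _); apply: val_inj.
- by rewrite -[RHS]b0; congr (p _ _); apply: val_inj.
- by rewrite -[RHS]c0; congr (p _ _); apply: val_inj.
Qed.

Lemma tangent_line_ex (F : finFieldType) (i : 'I_4) :
  i \in [:: 1; 3] ->
  exists2 l : pg_line F, tangent_line l &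
    val l = (<[nucleus_vec F]> + <[delta_mx 0%R i]>)%VS.
Proof.
move=> i13; set e : 'rV[F]_4 := delta_mx 0 i.
have [i0 i2] : ((0 : 'I_4) == i) = false /\ ((2 : 'I_4) == i) = false.
  by move: i13; rewrite !inE => /orP[]/eqP->.
have e0 : e != 0.
  by apply/eqP => /rowP/(_ i)/eqP; rewrite !mxE !eqxx oner_eq0.
have dl : \dim (<[nucleus_vec F]> + <[e]>)%VS == 2%N.
  rewrite dimv_disjoint_sum ?(eqP (dim_nucleus F)) ?dim_vline ?e0 //.
  apply/eqP; rewrite -subv0; apply/subvP => v.
  rewrite memv_cap memv0 => /andP[/vlineP[a ->] /vlineP[b]].
  move=> /rowP/(_ 2); rewrite !mxE !eqxx /= i2 mulr0 mulr1 => ->.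
  by rewrite scale0r.
exists (exist _ (<[nucleus_vec F]> + <[e]>)%VS dl) => //.
have lE v : v \in (<[nucleus_vec F]> + <[e]>)%VS ->
    exists a b, v = a *: nucleus_vec F + b *: e.
  by move=> /memv_addP[_ /vlineP[a ->] [_ /vlineP[b ->] ->]]; exists a, b.
apply/andP; split.
  apply/forall_inP => v /lE[a [b ->]].
  by rewrite !mxE /= i0 !mulr0 addr0.
have [E eE] := pg_point_gen e0.
apply/cards1P; exists E; apply/setP => Q; rewrite !inE -val_eqE.
apply/andP/eqP => [[/andP[_ /forall_inP Qq] Ql]|->]; last first.
  split; last by rewrite eE addvSr.
  suff: E \in conic F by rewrite inE.
  apply: (conic_mem eE); rewrite !mxE ?i0 ?i2 //= expr0n.
  by move: i13; rewrite !inE => /orP[]/eqP->; rewrite /= ?mulr0 ?mul0r.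
have [v v0 eQ] := pg_pointE Q; rewrite eQ in Qq Ql.
have [a [b ev]] : exists a b, v = a *: nucleus_vec F + b *: e.
  by apply: lE; rewrite memvE.
have := Qq v (memv_line v); rewrite ev !mxE /= i2 !mulr0 mulr1 addr0 !add0r.
have -> : b * ((1 : 'I_4) == i)%:R * (b * ((3 : 'I_4) == i)%:R) = 0.
  by move: i13; rewrite !inE => /orP[]/eqP->; rewrite /= ?mulr0 ?mul0r.
rewrite sub0r oppr_eq0 sqrf_eq0 => /eqP a0.
move: ev v0 eQ; rewrite a0 scale0r add0r => ->.
rewrite scaler_eq0 negb_or => /andP[b0 _] eQ.
apply/eqP; rewrite /= eQ eE eqEdim -memvE rpredZ ?memv_line //=.
by rewrite !dim_vline scaler_eq0 (negbTE b0) leqnn.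
Qed.

Lemma nucleusP (F : finFieldType) (P : pg_point F) :
  2 \in [pchar F] ->
  P = nucleus F <->
  (forall l : pg_line F, tangent_line l -> (val P <= val l)%VS).
Proof.
move=> char2; split=> [-> l|Pt]; first exact: nucleus_on_tangent.
have [l1 t1 e1] := @tangent_line_ex F 1 isT.
have [l3 t3 e3] := @tangent_line_ex F 3 isT.
have [v v0 eP] := pg_pointE P.
have := Pt _ t1; rewrite eP e1 -memvE => /memv_addP[_ /vlineP[a ->] [_ /vlineP[b ->] ev]].
have := Pt _ t3; rewrite eP e3 -memvE => /memv_addP[_ /vlineP[c ->] [_ /vlineP[d ->]]].
rewrite ev => /rowP/(_ 1); rewrite !mxE /= !mulr0 !add0r mulr1 => b0.
move: ev v0 eP; rewrite b0 scale0r addr0 => -> /[!(scaler_eq0, negb_or)] /andP[a0 n0] eP.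
apply: val_inj; apply/eqP; rewrite /= eP eqEdim -memvE rpredZ ?memv_line //=.
by rewrite !dim_vline scaler_eq0 (negbTE a0).
Qed.

(* Main.v *)
(** Affine points (1, x, y, z) and (1, x', y', z') are equal or collinear iff
    (x' - x)(z' - z) = (y' - y)^2 or (x, z) = (x', z').  A line through N is
    { (1, a, t, c) : t in F }.  The trace of (1, x, y, z) on it is the whole
    line if (x, z) = (a, c), and otherwise, in characteristic 2, the single
    point with t^2 = y^2 + (a - x)(c - z).  If two points have the same traces
    on the three lines, equating these values of t^2 gives one affine equation
    in (a, c) satisfied by all three lines; spanning means that the three
    points (a, c) are not collinear, so the linear coefficients z' - z and
    x' - x vanish, and then y^2 = y'^2. *)
Require Import Defs.
From mathcomp Require Import all_boot all_order all_algebra.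
From mathcomp Require Import all_field ring.

Set Implicit Arguments.
Unset Strict Implicit.
Unset Printing Implicit Defensive.

Import GRing.Theory.
Local Open Scope ring_scope.

Lemma eq_setI_mem (T : finType) (A B C : {set T}) (x : T) :
  A :&: C = B :&: C -> x \in C -> (x \in A) = (x \in B).
Proof. by move=> /setP/(_ x) + xC; rewrite !inE xC !andbT. Qed.

(** * Normalised coordinates of affine points and lines *)

Lemma row4P (T : Type) (u v : 'rV[T]_4) :
  u 0 0 = v 0 0 -> u 0 1 = v 0 1 -> u 0 2 = v 0 2 -> u 0 3 = v 0 3 -> u = v.
Proof.
move=> e0 e1 e2 e3; apply/rowP => -[[|[|[|[|//]]]] hi].
- by rewrite (_ : Ordinal hi = 0) //; apply: val_inj.
- by rewrite (_ : Ordinal hi = 1) //; apply: val_inj.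
- by rewrite (_ : Ordinal hi = 2) //; apply: val_inj.
- by rewrite (_ : Ordinal hi = 3) //; apply: val_inj.
Qed.

Lemma in_Hinf_vline (F : finFieldType) (v : 'rV[F]_4) :
  in_Hinf <[v]>%VS = (v 0 0 == 0).
Proof.
apply/forall_inP/eqP => [H | v0 _ /vlineP[k ->]].
  by apply/eqP/H/memv_line.
by rewrite mxE v0 mulr0.
Qed.

Lemma affine_neq0 (F : finFieldType) (p : 'rV[F]_4) : p 0 0 = 1 -> p != 0.
Proof.
by move=> p0; apply/eqP => pz; move/eqP: p0; rewrite pz mxE eq_sym oner_eq0.
Qed.

Lemma nucleus_vec_neq0 (F : finFieldType) : nucleus_vec F != 0.
Proof. by apply: contraTneq (dim_nucleus F) => ->; rewrite dim_vline eqxx. Qed.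

Lemma affine_vec_ex (F : finFieldType) (U : {vspace 'rV[F]_4}) :
  ~~ in_Hinf U -> exists2 v : 'rV[F]_4, v \in U & v 0 0 = 1.
Proof.
rewrite negb_forall_in => /exists_inP[v vU v0].
by exists ((v 0 0)^-1 *: v); rewrite ?rpredZ // mxE mulVf.
Qed.

Lemma affine_point_vecP (F : finFieldType) (P : affine_point F) :
  exists2 p : 'rV[F]_4, p 0 0 = 1 & val (val P) = <[p]>%VS.
Proof.
have [p pP p0] := affine_vec_ex (valP P); exists p => //; apply/esym/eqP.
by rewrite eqEdim -memvE pP (eqP (valP (val P))) dim_vline affine_neq0.
Qed.

Lemma affine_point_ex (F : finFieldType) (p : 'rV[F]_4) :
  p 0 0 = 1 -> exists P : affine_point F, val (val P) = <[p]>%VS.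
Proof.
move=> p0; have [R eR] := pg_point_gen (affine_neq0 p0).
have aR : ~~ in_Hinf (val R) by rewrite eR in_Hinf_vline p0 oner_neq0.
by exists (exist _ R aR).
Qed.

Lemma dim_affine_span (F : finFieldType) (p d : 'rV[F]_4) :
  p 0 0 = 1 -> d 0 0 = 0 -> d != 0 -> \dim (<[p]> + <[d]>)%VS == 2%N.
Proof.
move=> p0 d0 nd; rewrite dimv_disjoint_sum.
  by rewrite !dim_vline nd affine_neq0.
apply/eqP; rewrite -subv0; apply/subvP => v.
rewrite memv_cap memv0 => /andP[/vlineP[a ->] /vlineP[b]] /rowP/(_ 0).
by rewrite !mxE p0 d0 mulr1 mulr0 => ->; rewrite scale0r.
Qed.

Lemma affine_span (F : finFieldType) (U : {vspace 'rV[F]_4}) (p d : 'rV[F]_4) :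
  \dim U = 2%N -> p \in U -> d \in U -> p 0 0 = 1 -> d 0 0 = 0 -> d != 0 ->
  U = (<[p]> + <[d]>)%VS.
Proof.
move=> dU pU dU' p0 d0 nd; apply/esym/eqP.
by rewrite eqEdim subv_add -!memvE pU dU' dU (eqP (dim_affine_span p0 d0 nd)).
Qed.

Lemma affine_span_inf (F : finFieldType) (p d v : 'rV[F]_4) :
  p 0 0 = 1 -> d 0 0 = 0 -> v 0 0 = 0 -> v \in (<[p]> + <[d]>)%VS ->
  exists b, v = b *: d.
Proof.
move=> p0 d0 v0 /memv_addP[_ /vlineP[a ->] [_ /vlineP[b ->] ev]].
exists b; move: v0; rewrite ev !mxE p0 d0 mulr1 mulr0 addr0 => ->.
by rewrite scale0r add0r.
Qed.

(** * Collinearity in terms of directions at infinity *)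

(** When [X_0 = 0], the first alternative describes the nucleus and the second the conic. The zero
    vector passes, so that a point counts in its own closed neighbourhood. *)
Definition hyperoval_vec (F : finFieldType) (d : 'rV[F]_4) : bool :=
  (d 0 1 == 0) && (d 0 3 == 0) || (d 0 1 * d 0 3 == d 0 2 ^+ 2).

Lemma hyperoval_vecZ (F : finFieldType) (b : F) (d : 'rV[F]_4) :
  hyperoval_vec d -> hyperoval_vec (b *: d).
Proof.
rewrite /hyperoval_vec !mxE => /orP[/andP[/eqP-> /eqP->] | /eqP e].
  by rewrite mulr0 eqxx.
by rewrite mulrACA e exprMn expr2 eqxx orbT.
Qed.

Lemma hyperovalP (F : finFieldType) (R : pg_point F) (d : 'rV[F]_4) :
  val R = <[d]>%VS -> (R \in hyperoval F) = (d 0 0 == 0) && hyperoval_vec d.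
Proof.
move=> eR; have nd : d != 0.
  by apply: contraTneq (valP R) => d0; rewrite eR d0 dim_vline eqxx.
rewrite in_setU1; apply/orP/andP => [[/eqP RN | ] | [/eqP d0]].
- have: d \in <[nucleus_vec F]>%VS.
    by move: eR; rewrite RN /= => ->; apply: memv_line.
  by case/vlineP => k ->; rewrite /hyperoval_vec !mxE /= !mulr0 !eqxx.
- rewrite inE eR in_Hinf_vline => /andP[-> /forall_inP/(_ d (memv_line d))].
  by rewrite subr_eq0 /hyperoval_vec => ->; rewrite orbT.
rewrite /hyperoval_vec => /orP[/andP[/eqP d1 /eqP d3] | /eqP dq]; last first.
  by right; apply: (conic_mem eR).
left; apply/eqP/val_inj/eqP; rewrite /= eR eqEdim !dim_vline nd -memvE.
have dE : d = d 0 2 *: nucleus_vec F.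
  by apply: row4P; rewrite !mxE /= ?mulr0 ?mulr1.
by rewrite {1}dE rpredZ ?memv_line ?nucleus_vec_neq0.
Qed.

(** Since both representatives have [X_0 = 1], for distinct points [q - p] spans the point at
    infinity of the joining line; for equal points it is zero. *)
Lemma closed_nbhdE (F : finFieldType) (P Q : affine_point F) (p q : 'rV[F]_4) :
  p 0 0 = 1 -> q 0 0 = 1 -> val (val P) = <[p]>%VS -> val (val Q) = <[q]>%VS ->
  (Q \in closed_nbhd (@T2star_adj F) P) = hyperoval_vec (q - p).
Proof.
move=> p0 q0 eP eQ; rewrite inE /T2star_adj.
have d0 : (q - p) 0 0 = 0 by rewrite !mxE p0 q0 subrr.
have [QP | nQP] /= := eqVneq Q P.
  have: q \in <[p]>%VS by rewrite -eP -QP eQ memv_line.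
  case/vlineP => k qk; move: q0; rewrite qk mxE p0 mulr1 => ->.
  by rewrite scale1r subrr /hyperoval_vec !mxE eqxx.
have nd : q - p != 0.
  apply: contra_neq nQP => /eqP; rewrite subr_eq0 => /eqP qp.
  by do 2!apply: val_inj; rewrite eP eQ qp.
apply/exists_inP/idP => [[l] | hd].
  rewrite inE => /andP[aff /exists_inP[R RO Rl]] /andP[].
  rewrite /affine_on eP eQ -!memvE => pl ql.
  have [r nr eR] := pg_pointE R.
  move: RO; rewrite (hyperovalP eR) => /andP[/eqP r0 hr].
  move: Rl; rewrite eR -memvE => rl.
  (* The line [l] meets the plane at infinity only in [<[r]>], which forces [q - p] to be a multiple
     of [r]. *)
  have lE := affine_span (eqP (valP l)) pl rl p0 r0 nr.
  have dl : q - p \in (<[p]> + <[r]>)%VS by rewrite -lE rpredB.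
  by have [b ->] := affine_span_inf p0 r0 d0 dl; apply: hyperoval_vecZ.
have dl : \dim (<[p]> + <[q - p]>)%VS == 2%N by rewrite dim_affine_span.
exists (exist _ (<[p]> + <[q - p]>)%VS dl : pg_line F);
  rewrite /affine_on /= ?eP ?eQ -?memvE.
  rewrite inE /=; apply/andP; split.
    apply/negP => /forall_inP/(_ p); rewrite p0 (negbTE (oner_neq0 _)).
    by move/(_ (subvP (addvSl _ _) _ (memv_line p))).
  have [R eR] := pg_point_gen nd.
  by apply/exists_inP; exists R; rewrite ?(hyperovalP eR) ?d0 ?eqxx ?eR ?addvSr.
rewrite (subvP (addvSl _ _)) ?memv_line //=.
by rewrite -[X in X \in _](subrK p) addrC memv_add ?memv_line.
Qed.

(** * Lines through the nucleus *)

Lemma nucleus_line_vecP (F : finFieldType) (l : pg_line F) :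
  l \in T2star_lines F -> (val (nucleus F) <= val l)%VS ->
  exists2 w : 'rV[F]_4, w 0 0 = 1 &
    val l = (<[w]> + <[nucleus_vec F]>)%VS.
Proof.
rewrite inE => /andP[/affine_vec_ex[w wl w0] _]; rewrite /= -memvE => nl.
have n0 : nucleus_vec F 0 0 = 0 by rewrite mxE.
exists w => //.
exact: affine_span (eqP (valP l)) wl nl w0 n0 (nucleus_vec_neq0 F).
Qed.

(** Adding a multiple of the nucleus vector changes only [X_2], and [X_0 = 1] fixes the scaling. *)
Lemma affine_on_nucleus_line (F : finFieldType) (P : affine_point F)
    (l : pg_line F) (p w : 'rV[F]_4) :
  p 0 0 = 1 -> w 0 0 = 1 -> val (val P) = <[p]>%VS ->
  val l = (<[w]> + <[nucleus_vec F]>)%VS ->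
  affine_on P l = (p 0 1 == w 0 1) && (p 0 3 == w 0 3).
Proof.
move=> p0 w0 eP el.
rewrite /affine_on eP -memvE el; apply/memv_addP/andP.
  case=> _ /vlineP[a ->] [_ /vlineP[b ->] pE].
  move: p0; rewrite pE !mxE w0 /= !mulr0 mulr1 !addr0 => ->.
  by rewrite !mul1r !eqxx.
case=> /eqP p1 /eqP p3; exists w; rewrite ?memv_line //.
exists ((p 0 2 - w 0 2) *: nucleus_vec F); first by rewrite rpredZ ?memv_line.
apply: row4P; rewrite !mxE ?p0 ?w0 ?p1 ?p3 /= ?mulr0 ?addr0 //.
by rewrite mulr1 addrC subrK.
Qed.

(** * Traces on lines through the nucleus in characteristic 2 *)

Lemma sqrf_pcharB (F : fieldType) (a b : F) :
  2 \in [pchar F] -> (a - b) ^+ 2 = a ^+ 2 - b ^+ 2.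
Proof. by move=> c2; rewrite -!(pFrobenius_autE c2) rmorphB. Qed.

(** Frobenius is injective, hence bijective on a finite field. *)
Lemma sqrt_pchar2 (F : finFieldType) (D : F) :
  2 \in [pchar F] -> exists t, t ^+ 2 = D.
Proof.
move=> c2; have /injF_bij[g _ gK] := fmorph_inj (pFrobenius_aut c2).
by exists (g D); rewrite -(pFrobenius_autE c2) gK.
Qed.

(* The square of the X_2-coordinate of the unique point collinear with [u] on
   the line joining [w] to the nucleus, when [u] is off that line. *)
Definition trace_param (F : finFieldType) (u w : 'rV[F]_4) : F :=
  u 0 2 ^+ 2 + (w 0 1 - u 0 1) * (w 0 3 - u 0 3).

Lemma hyperoval_vec_on (F : finFieldType) (u w : 'rV[F]_4) (t : F) :
  w 0 1 = u 0 1 -> w 0 3 = u 0 3 ->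
  hyperoval_vec (w + t *: nucleus_vec F - u).
Proof.
by move=> e1 e3; rewrite /hyperoval_vec !mxE /= mulr0 !addr0 e1 e3 !subrr eqxx.
Qed.

(** Off the line the nucleus alternative fails; in the conic equation additivity of squaring
    isolates the term containing [t]. *)
Lemma hyperoval_vec_off (F : finFieldType) (u w : 'rV[F]_4) (t : F) :
  2 \in [pchar F] -> (w 0 1 != u 0 1) || (w 0 3 != u 0 3) ->
  hyperoval_vec (w + t *: nucleus_vec F - u) =
  ((w 0 2 + t) ^+ 2 == trace_param u w).
Proof.
move=> c2 off; rewrite /hyperoval_vec /trace_param !mxE /= mulr0 mulr1 !addr0.
rewrite !subr_eq0 -[_ && _]negbK negb_and off /= sqrf_pcharB //.
by rewrite eq_sym subr_eq [X in _ == X]addrC.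
Qed.

Lemma trace_param_root (F : finFieldType) (w : 'rV[F]_4) (D : F) :
  2 \in [pchar F] -> exists t, (w 0 2 + t) ^+ 2 == D.
Proof.
move=> c2; have [s sE] := sqrt_pchar2 D c2.
by exists (s - w 0 2); rewrite addrC subrK sE.
Qed.

(* If [v] lay on the line joining [w] to the nucleus, its trace would be the
   whole line, whereas the trace of [u] is a single point. *)
Lemma trace_param_eq (F : finFieldType) (u v w : 'rV[F]_4) :
  2 \in [pchar F] ->
  (forall t, hyperoval_vec (w + t *: nucleus_vec F - u) =
             hyperoval_vec (w + t *: nucleus_vec F - v)) ->
  (w 0 1 != u 0 1) || (w 0 3 != u 0 3) ->
  ((w 0 1 != v 0 1) || (w 0 3 != v 0 3)) /\ trace_param u w = trace_param v w.
Proof.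
move=> c2 tr offu.
have offv : (w 0 1 != v 0 1) || (w 0 3 != v 0 3).
  rewrite -negb_and; apply/negP => /andP[/eqP v1 /eqP v3].
  have full t : (w 0 2 + t) ^+ 2 = trace_param u w.
    by apply/eqP; rewrite -(hyperoval_vec_off t c2 offu) tr hyperoval_vec_on.
  (* These two values of [t] would make the constant square both 1 and 0. *)
  have := full (1 - w 0 2); rewrite -(full (- w 0 2)) subrr addrC subrK.
  by move/eqP; rewrite expr1n expr0n oner_eq0.
split=> //; have [t tu] := trace_param_root w (trace_param u w) c2.
move: (tr t); rewrite !hyperoval_vec_off // tu => /esym/eqP <-.
exact/esym/eqP.
Qed.

(** * Separation by three spanning lines *)

(** The linear form [f] kills the nucleus vector, so vanishing at each [w] makes it vanish on each
    line and hence everywhere; unit vectors then read off [a] and [c]. *)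
Lemma span_noncollinear (F : finFieldType) (l1 l2 l3 : {vspace 'rV[F]_4})
    (w1 w2 w3 : 'rV[F]_4) (k a c : F) :
  l1 = (<[w1]> + <[nucleus_vec F]>)%VS ->
  l2 = (<[w2]> + <[nucleus_vec F]>)%VS ->
  l3 = (<[w3]> + <[nucleus_vec F]>)%VS ->
  (l1 + l2 + l3)%VS = fullv ->
  {in [:: w1; w2; w3],
     forall w : 'rV[F]_4, k * w 0 0 + a * w 0 1 + c * w 0 3 = 0} ->
  a = 0 /\ c = 0.
Proof.
move=> e1 e2 e3 span kerw.
pose f (v : 'rV[F]_4) := k * v 0 0 + a * v 0 1 + c * v 0 3.
have fD u v : f (u + v) = f u + f v by rewrite /f !mxE; ring.
have fl w v : f w = 0 -> v \in (<[w]> + <[nucleus_vec F]>)%VS -> f v = 0.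
  move=> fw /memv_addP[_ /vlineP[x ->] [_ /vlineP[y ->] ->]].
  by rewrite -[RHS](mulr0 x) -fw /f !mxE /=; ring.
have f0 v : f v = 0.
  have: v \in (l1 + l2 + l3)%VS by rewrite span memvf.
  case/memv_addP => _ /memv_addP[v1 v1l [v2 v2l ->]] [v3 v3l ->].
  rewrite !fD (fl w1 v1) ?(fl w2 v2) ?(fl w3 v3) ?addr0 -?e1 -?e2 -?e3 //;
    by apply: kerw; rewrite !inE eqxx ?orbT.
have := f0 (delta_mx 0 3); have := f0 (delta_mx 0 1).
by rewrite /f !mxE /= !mulr0 !mulr1 !addr0 !add0r.
Qed.

Lemma trace_inj (F : finFieldType) (ws : seq 'rV[F]_4) (u v : 'rV[F]_4) :
  2 \in [pchar F] -> u 0 0 = 1 -> v 0 0 = 1 ->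
  (forall w, w \in ws -> w 0 0 = 1) ->
  (forall k a c, {in ws,
     forall w : 'rV[F]_4, k * w 0 0 + a * w 0 1 + c * w 0 3 = 0} ->
     a = 0 /\ c = 0) ->
  (forall w t, w \in ws -> hyperoval_vec (w + t *: nucleus_vec F - u) =
     hyperoval_vec (w + t *: nucleus_vec F - v)) ->
  u = v.
Proof.
move=> c2 u0 v0 ws0 ncol tr.
have [w wW offu] : exists2 w, w \in ws & (w 0 1 != u 0 1) || (w 0 3 != u 0 3).
  apply/hasP; apply/negPn/hasPn => onu.
  (* If [u] were on every line, the form [X_1 - u 0 1 * X_0] would vanish on [ws], although its
     [X_1] coefficient is 1. *)
  have [] := ncol (- u 0 1) 1 0; last by move/eqP; rewrite oner_eq0.
  move=> w wW; have := onu w wW; rewrite -negb_and negbK => /andP[/eqP-> _].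
  by rewrite ws0 //; ring.
have [_ tw] := trace_param_eq c2 (fun t => tr w t wW) offu.
suff [e13 e33] : u 0 1 = v 0 1 /\ u 0 3 = v 0 3.
  suff e23 : u 0 2 = v 0 2 by exact: row4P (etrans u0 (esym v0)) e13 e23 e33.
  move/eqP: tw; rewrite /trace_param e13 e33 (inj_eq (addIr _)) -subr_eq0.
  by rewrite -(sqrf_pcharB _ _ c2) sqrf_eq0 subr_eq0 => /eqP.
have [/andP[/eqP-> /eqP->] // | ne] :=
  boolP ((u 0 1 == v 0 1) && (u 0 3 == v 0 3)).
have param x : x \in ws -> trace_param u x = trace_param v x.
  move=> xW; have [offux | ] := boolP ((x 0 1 != u 0 1) || (x 0 3 != u 0 3)).
    by have [] := trace_param_eq c2 (fun t => tr x t xW) offux.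
  rewrite -negb_and negbK => /andP[/eqP x1 /eqP x3].
  have offvx : (x 0 1 != v 0 1) || (x 0 3 != v 0 3) by rewrite -negb_and x1 x3.
  (* Here [u] is on the line of [x] and [v] is off it; with the roles exchanged, [u] would have to
     be off it too. *)
  have [] := trace_param_eq c2 (fun t => esym (tr x t xW)) offvx.
  by rewrite x1 x3 !eqxx.
(* These are the coefficients of [trace_param u x - trace_param v x] in [x]; the product
   [x 0 1 * x 0 3] cancels. *)
have [] := ncol (u 0 2 ^+ 2 - v 0 2 ^+ 2 + u 0 1 * u 0 3 - v 0 1 * v 0 3)
  (v 0 3 - u 0 3) (v 0 1 - u 0 1).
  move=> x xW; rewrite ws0 // -[RHS](subrr (trace_param v x)) -{1}(param x xW).
  by rewrite /trace_param; ring.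
by move=> /eqP/[!subr_eq0]/eqP-> /eqP/[!subr_eq0]/eqP->.
Qed.

Theorem theorem4p16 (F : finFieldType) (q h : nat)
    (hq : q = (2 ^ h)%N) (hF : #|F| = q)
    (l1 l2 l3 : pg_line F)
    (hl1 : l1 \in T2star_lines F) (hl2 : l2 \in T2star_lines F)
    (hl3 : l3 \in T2star_lines F)
    (hN1 : (val (nucleus F) <= val l1)%VS)
    (hN2 : (val (nucleus F) <= val l2)%VS)
    (hN3 : (val (nucleus F) <= val l3)%VS)
    (hspan : (val l1 + val l2 + val l3)%VS = fullv) :
  identifying_code (@T2star_adj F)
    [set P : affine_point F | [|| affine_on P l1, affine_on P l2 | affine_on P l3]].
Proof.
have c2 : 2 \in [pchar F] by apply: (@card_finPcharP F 2 h) => //; rewrite hF.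
have [w1 w10 e1] := nucleus_line_vecP hl1 hN1.
have [w2 w20 e2] := nucleus_line_vecP hl2 hN2.
have [w3 w30 e3] := nucleus_line_vecP hl3 hN3.
set C := [set P | _]; pose ws := [:: w1; w2; w3].
have ws0 w : w \in ws -> w 0 0 = 1 by rewrite !inE => /or3P[] /eqP->.
have inC P p w t : w \in ws -> p = w + t *: nucleus_vec F ->
    val (val P) = <[p]>%VS -> P \in C.
  move=> wW pE eP; have p0 : p 0 0 = 1 by rewrite pE !mxE mulr0 addr0 ws0.
  have p1 : p 0 1 = w 0 1 by rewrite pE !mxE mulr0 addr0.
  have p3 : p 0 3 = w 0 3 by rewrite pE !mxE mulr0 addr0.
  rewrite inE (affine_on_nucleus_line p0 w10 eP e1).
  rewrite (affine_on_nucleus_line p0 w20 eP e2).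
  rewrite (affine_on_nucleus_line p0 w30 eP e3) p1 p3.
  by move: wW; rewrite !inE => /or3P[] /eqP->; rewrite !eqxx ?orbT.
clearbody C; have codeP w t : w \in ws -> exists2 R, R \in C &
    (w + t *: nucleus_vec F) 0 0 = 1 /\
    val (val R) = <[w + t *: nucleus_vec F]>%VS.
  move=> wW; have r0 : (w + t *: nucleus_vec F) 0 0 = 1.
    by rewrite !mxE mulr0 addr0 ws0.
  have [R eR] := affine_point_ex r0.
  by exists R; first exact: inC wW erefl eR.
split=> [P | P Q].
  have [p p0 eP] := affine_point_vecP P.
  (* The first line alone meets every closed neighbourhood: off it the root of the trace equation
     works, and on it any [t] does. *)
  have [t ht] : exists t, hyperoval_vec (w1 + t *: nucleus_vec F - p).
    have [t ht] := trace_param_root w1 (trace_param p w1) c2.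
    exists t; have [off | ] := boolP ((w1 0 1 != p 0 1) || (w1 0 3 != p 0 3)).
      by rewrite hyperoval_vec_off.
    by rewrite -negb_and negbK => /andP[/eqP ? /eqP ?]; apply: hyperoval_vec_on.
  have [R RC [r0 eR]] := codeP w1 t (mem_head _ _).
  apply/set0Pn; exists R; apply/setIP; split; last exact: RC.
  by rewrite (closed_nbhdE p0 r0 eP eR).
apply: contra_neq => eqN.
have [u u0 eP] := affine_point_vecP P; have [v v0 eQ] := affine_point_vecP Q.
(* Every [w + t *: nucleus_vec F] represents a code point, so equal codes give equal traces. *)
have tr w t : w \in ws -> hyperoval_vec (w + t *: nucleus_vec F - u) =
    hyperoval_vec (w + t *: nucleus_vec F - v).
  move=> wW; have [R RC [r0 eR]] := codeP w t wW.
  have EP := closed_nbhdE u0 r0 eP eR; have EQ := closed_nbhdE v0 r0 eQ eR.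
  exact: etrans (esym EP) (etrans (eq_setI_mem eqN RC) EQ).
have ncol := span_noncollinear e1 e2 e3 hspan.
do 2!apply: val_inj; rewrite eP eQ; congr <[_]>%VS.
exact: (trace_inj c2 u0 v0 ws0 ncol tr).
Qed.
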